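(* Let $n\geq 2$ and let $D\subset\mathbb{C}^n$ be a bounded $\mathbb{C}$-convex domain. Then for every $z\in D$, $$v_D(z)\geq \frac{1}{\left(16n\,\operatorname{diam}^2(D)\right)^n}$$ both for $v_D=c_D$ (the Carathéodory-Eisenman volume element) and for $v_D=k_D$ (the Kobayashi-Eisenman volume element), where $\operatorname{diam}(D)$ is the diameter of $D$ and $\operatorname{diam}^2(D)=(\operatorname{diam}(D))^2$.
   Context: A domain is a nonempty connected open set. A domain $D\subset\mathbb{C}^n$ is $\mathbb{C}$-convex if $D\cap l$ is a simply connected domain (in particular connected) for each complex affine line $l$ that meets $D$. $\mathbb{B}^n$ is the open unit ball of $\mathbb{C}^n$, $\mathcal{O}(X,Y)$ is the set of holomorphic maps from $X$ to $Y$, and $\det\psi'$ is the complex Jacobian determinant of a holomorphic map $\psi$. The diameter is Euclidean. The Carathéodory and Kobayashi-Eisenman volume elements of a domain $D\subset \mathbb{C}^n$ at $z^0\in D$ are $$c_D(z^0)=\sup\{|\det\psi'(z^0)|^2:\psi\in\mathcal{O}(D,\mathbb{B}^n),\ \psi(z^0)=0\},$$ $$k_D(z^0)=\inf\{|\det\psi'(0)|^{-2}:\psi\in\mathcal{O}(\mathbb{B}^n,D),\ \psi(0)=z^0\}$$ (with $|\det\psi'(0)|^{-2}=+\infty$ if $\det\psi'(0)=0$). *)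

(* Defs.v *)
From mathcomp Require Import all_boot all_order all_algebra.
From mathcomp Require Import complex.
From mathcomp Require Import all_classical all_reals all_analysis.

Set Implicit Arguments.
Unset Strict Implicit.
Unset Printing Implicit Defensive.

Import Order.TTheory GRing.Theory Num.Theory.
Import numFieldNormedType.Exports.

Local Open Scope classical_set_scope.
Local Open Scope ring_scope.

(* [R[i]] carries no topology by itself; seen as a [numClosedFieldType] it gets
   the topology of its modulus, and ['rV[Cplx R]_n] becomes a normed module over
   [Cplx R], so that [differentiable] means complex differentiable and ['J f z]
   is the complex Jacobian matrix. *)
Definition Cplx (R : realType) : numClosedFieldType := R[i].

Definition cmod (R : realType) (x : Cplx R) : R := Normc.normc x.

(* The norm of the normed module ['rV_n] is the sup norm, hence: *)
Definition enorm (R : realType) (n : nat) (z : 'rV[Cplx R]_n) : R :=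
  Num.sqrt (\sum_(j < n) cmod (z 0 j) ^+ 2).

Definition uball (R : realType) (n : nat) : set 'rV[Cplx R]_n :=
  [set z | enorm z < 1].

(* Real-valued supremum: meaningful for nonempty bounded sets. *)
Definition diam (R : realType) (n : nat) (D : set 'rV[Cplx R]_n) : R :=
  sup [set enorm (x - y) | x in D & y in D].

Definition domain (T : topologicalType) (D : set T) : Prop :=
  [/\ D !=set0, open D & connected D].

Definition path_in (R : realType) (T : topologicalType) (S : set T)
    (g : R -> T) : Prop :=
  {within `[0, 1], continuous g} /\ (forall t, t \in `[0, 1] -> S (g t)).

Definition path_connected (R : realType) (T : topologicalType) (S : set T) :=
  forall x y, S x -> S y ->
  exists g : R -> T, [/\ path_in S g, g 0 = x & g 1 = y].

(* The first argument of [H] is the deformation parameter. *)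
Definition null_homotopic (R : realType) (T : topologicalType) (S : set T)
    (g : R -> T) : Prop :=
  exists H : R * R -> T,
    [/\ {within `[0, 1] `*` `[0, 1], continuous H},
        forall s t, s \in `[0, 1] -> t \in `[0, 1] -> S (H (s, t)),
        forall t, t \in `[0, 1] -> H (0, t) = g t,
        forall t, t \in `[0, 1] -> H (1, t) = g 0 &
        forall s, s \in `[0, 1] -> H (s, 0) = g 0 /\ H (s, 1) = g 0].

Definition simply_connected (R : realType) (T : topologicalType) (S : set T) :=
  path_connected R S /\
  forall g : R -> T, path_in S g -> g 0 = g 1 -> null_homotopic S g.

(* [D] intersected with the complex line [a + C b], [b != 0], the line being
   identified with the complex plane through [t |-> a + t b]. *)
Definition line_section (R : realType) (n : nat) (D : set 'rV[Cplx R]_n)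
    (a b : 'rV[Cplx R]_n) : set (Cplx R) :=
  [set t | D (a + t *: b)].

Definition C_convex (R : realType) (n : nat) (D : set 'rV[Cplx R]_n) : Prop :=
  forall a b : 'rV[Cplx R]_n, b != 0 -> line_section D a b !=set0 ->
  domain (line_section D a b) /\ simply_connected R (line_section D a b).

(* Only used for [X] open, so that differentiability at the points of [X] does
   not depend on the values outside of [X]. *)
Definition holo (R : realType) (n m : nat) (X : set 'rV[Cplx R]_n)
    (Y : set 'rV[Cplx R]_m) : set ('rV[Cplx R]_n -> 'rV[Cplx R]_m) :=
  [set f | (forall z, X z -> differentiable f z) /\
           (forall z, X z -> Y (f z))].

Definition jac2 (R : realType) (n : nat)
    (f : 'rV[Cplx R]_n -> 'rV[Cplx R]_n) (z : 'rV[Cplx R]_n) : R :=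
  cmod (\det ('J f z)) ^+ 2.

Definition caratheodory_vol (R : realType) (n : nat) (D : set 'rV[Cplx R]_n)
    (z : 'rV[Cplx R]_n) : \bar R :=
  ereal_sup [set (jac2 psi z)%:E | psi in
    [set psi | holo D (@uball R n) psi /\ psi z = 0]].

(* In [\bar R], the inverse of [0] is [+oo]. *)
Definition kobayashi_vol (R : realType) (n : nat) (D : set 'rV[Cplx R]_n)
    (z : 'rV[Cplx R]_n) : \bar R :=
  ereal_inf [set ((jac2 psi 0)%:E^-1)%E | psi in
    [set psi | holo (@uball R n) D psi /\ psi 0 = z]].

(* Main.v *)
(** Write [d] for the diameter. The affine map [w |-> (w - z) / (2 d)] sends [D]
    into the ball, which bounds [caratheodory_vol] from below. For
    [kobayashi_vol], let [psi] be a competitor with Jacobian [J] at [0]; the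
    determinant is the product of the eigenvalues, so it suffices that
    [|l| <= 4 sqrt n d] whenever [v J = l v] with [v != 0]. Restricting to the
    line spanned by [v] the coordinate of [psi] at which [v] is largest reduces
    this to [|f'(0)| <= 4 M] for a holomorphic [f] on the unit disc with
    [|f| <= M] and [f(0) = 0].

    That estimate comes from Cauchy's theorem for [f(z) / z^2] on the shell
    between the squares of half-sides [1/2] and [s/2], with [s] small. Contour
    integrals are replaced by midpoint sums over [2^k] equal pieces of each side:
    these have exactly the additivity needed to run Goursat's subdivision, so
    around a triangle they tend to [0] as [k] grows. *)
From HB Require Import structures.
Require Import Defs.
From mathcomp Require Import all_boot all_order all_algebra.
From mathcomp Require Import complex.
From mathcomp Require Import all_classical all_reals all_analysis.
From mathcomp Require Import ring lra.
Import Order.TTheory GRing.Theory Num.Theory.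
Import numFieldNormedType.Exports.
Local Open Scope classical_set_scope.
Local Open Scope ring_scope.

Set Implicit Arguments.
Unset Strict Implicit.
Unset Printing Implicit Defensive.

(** * The modulus *)

Section ComplexModulus.
Context {R : realType}.
Implicit Types (x y z : Cplx R).

Lemma normCplx x : `|x| = (cmod x)%:C%C :> Cplx R.
Proof. by []. Qed.

Lemma cmod_ge0 x : 0 <= cmod x.
Proof. by case: x => a b; exact: sqrtr_ge0. Qed.

Lemma cmod0 : cmod (0 : Cplx R) = 0.
Proof. exact: Normc.normc0. Qed.

Lemma cmod1 : cmod (1 : Cplx R) = 1.
Proof. exact: Normc.normc1. Qed.

Lemma cmod_eq0 x : (cmod x == 0) = (x == 0).
Proof.
by apply/eqP/eqP => [/Normc.eq0_normc//|->]; exact: cmod0.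
Qed.

Lemma cmod_gt0 x : (0 < cmod x) = (x != 0).
Proof. by rewrite lt_def cmod_ge0 cmod_eq0 andbT. Qed.

Lemma cmodD x y : cmod (x + y) <= cmod x + cmod y.
Proof. exact: le_normcD. Qed.

Lemma cmodM x y : cmod (x * y) = cmod x * cmod y.
Proof. exact: Normc.normcM. Qed.

Lemma cmodN x : cmod (- x) = cmod x.
Proof. exact: normcN. Qed.

Lemma cmodV x : cmod x^-1 = (cmod x)^-1.
Proof. exact: Normc.normcV. Qed.

Lemma cmodX x n : cmod (x ^+ n) = cmod x ^+ n.
Proof.
elim: n => [|n IH]; first by rewrite !expr0 cmod1.
by rewrite !exprS cmodM IH.
Qed.

Lemma cmodB x y : cmod (x - y) = cmod (y - x).
Proof. by rewrite -cmodN opprB. Qed.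

Lemma cmod_triangle y x z : cmod (x - z) <= cmod (x - y) + cmod (y - z).
Proof. by rewrite -[x - z](subrKA y); exact: cmodD. Qed.

Lemma cmod_real (r : R) : cmod (r%:C%C : Cplx R) = `|r|.
Proof. by rewrite /cmod /= expr0n /= addr0 sqrtr_sqr. Qed.

Lemma cmod_half x : cmod (x / 2) = cmod x / 2.
Proof.
rewrite cmodM cmodV -[2 in LHS]/(2%:R) -(rmorph_nat (real_complex R)).
by rewrite cmod_real ger0_norm.
Qed.

Lemma cmod_Re x : `|complex.Re x| <= cmod x.
Proof.
case: x => a b /=; rewrite /cmod /= -sqrtr_sqr ler_wsqrtr// lerDl.
exact: sqr_ge0.
Qed.

Lemma cmod_Im x : `|complex.Im x| <= cmod x.
Proof.
case: x => a b /=; rewrite /cmod /= -sqrtr_sqr ler_wsqrtr// lerDr.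
exact: sqr_ge0.
Qed.

Lemma cmod_le_ReIm x : cmod x <= `|complex.Re x| + `|complex.Im x|.
Proof.
case: x => a b /=; rewrite /cmod /= -[leRHS]ger0_norm ?addr_ge0//.
rewrite -sqrtr_sqr ler_wsqrtr// sqrrD !real_normK ?num_real//.
by rewrite lerD2r lerDl mulrn_wge0// mulr_ge0.
Qed.

End ComplexModulus.

(** * Midpoint sums and Goursat's lemma *)

Section GeometricLimits.
Context {R : realType}.

Lemma expr_half_lt (x : R) : 0 < x -> exists k, (2^-1 : R) ^+ k < x.
Proof.
move=> x0; have h : (fun k => (2^-1 : R) ^+ k) @ \oo --> (0 : R).
  by apply: cvg_expr; rewrite ger0_norm; lra.
move/cvgrPdist_lt : h => /(_ _ x0) [k _ hk]; exists k.
by have := hk k (leqnn k); rewrite /= sub0r normrN ger0_norm// exprn_ge0.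
Qed.

(** The sequences u_k - 2 d 2^-k and u_k + 2 d 2^-k are monotone in opposite directions and enclose
    [u]; the supremum of the lower one is the limit. *)
Lemma geometric_limit (d : R) (u : nat -> R) :
  (forall k, `|u k.+1 - u k| <= d * 2^-1 ^+ k) ->
  exists l, forall k, `|u k - l| <= 2 * d * 2^-1 ^+ k.
Proof.
move=> hu.
have d0 : 0 <= d by have := hu 0%N; rewrite expr0; have := normr_ge0 (u 1%N - u 0%N); lra.
pose v k := u k - 2 * d * 2^-1 ^+ k.
pose w k := u k + 2 * d * 2^-1 ^+ k.
have vw k : v k <= w k.
  have h : 0 <= d * 2^-1 ^+ k by rewrite mulr_ge0// exprn_ge0.
  by rewrite /v /w; lra.
have vS k : v k <= v k.+1.
  by have := hu k; rewrite /v exprS ler_norml; lra.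
have wS k : w k.+1 <= w k.
  by have := hu k; rewrite /w exprS ler_norml; lra.
have vm i j : (i <= j)%N -> v i <= v j.
  exact: (@homo_leq _ v <=%R (fun x => lexx x) le_trans vS).
have wm i j : (i <= j)%N -> w j <= w i.
  apply: (@homo_leq _ w (fun x y => y <= x)) => //.
  by move=> y x z xy yz; exact: le_trans xy.
have vwij i j : v i <= w j.
  apply: le_trans (vm _ _ (leq_maxl i j)) _.
  exact: le_trans (vw _) (wm _ _ (leq_maxr i j)).
have hs : has_sup (range v).
  by split; [exists (v 0%N), 0%N | exists (w 0%N) => _ [i _ <-]].
exists (sup (range v)) => k.
have h1 : v k <= sup (range v) by apply: (ub_le_sup hs.2); exists k.
have h2 : sup (range v) <= w k by apply: (ge_sup hs.1) => _ [i _ <-].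
by move: h1 h2; rewrite /v /w ler_norml; lra.
Qed.

Lemma geometric_limit_Cplx (d : R) (u : nat -> Cplx R) :
  (forall k, cmod (u k.+1 - u k) <= d * 2^-1 ^+ k) ->
  exists l, forall k, cmod (u k - l) <= 4 * d * 2^-1 ^+ k.
Proof.
move=> hu.
have [k|x hx] := @geometric_limit d (fun k => complex.Re (u k)).
  apply: le_trans (hu k); apply: le_trans (cmod_Re _).
  by case: (u k) (u k.+1) => ? ? [? ?].
have [k|y hy] := @geometric_limit d (fun k => complex.Im (u k)).
  apply: le_trans (hu k); apply: le_trans (cmod_Im _).
  by case: (u k) (u k.+1) => ? ? [? ?].
exists (Complex x y) => k; apply: le_trans (cmod_le_ReIm _) _.
have := lerD (hx k) (hy k); case: (u k) => a b /=; lra.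
Qed.

End GeometricLimits.

(** * Midpoint sums along segments and around triangles *)

Section Goursat.
Context {R : realType}.
Local Notation C := (Cplx R).
Implicit Types (F G : C -> C) (a b c z w : C) (K : set C).

(** Linear approximation with real tolerances; having no quotient, it includes the case w = z. *)
Definition has_cderiv G z c := forall e : R, 0 < e ->
  exists2 d : R, 0 < d & forall w, cmod (w - z) < d ->
    cmod (G w - G z - c * (w - z)) <= e * cmod (w - z).

(** Subdivision only produces midpoints, so this can stand in for convexity. *)
Definition mid_convex K := forall a b, K a -> K b -> K ((a + b) / 2).

Definition cmod_closed K :=
  forall w, (forall e : R, 0 < e -> exists2 z, K z & cmod (z - w) < e) -> K w.

(** The midpoint rule with 2^k equal pieces for the integral of [G] from [a] to [b]. Recursion on
    halves makes additivity at the midpoint definitional, at the cost of one level. *)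
Fixpoint midsum k G a b : C :=
  if k is k'.+1 then midsum k' G a ((a + b) / 2) + midsum k' G ((a + b) / 2) b
  else G ((a + b) / 2) * (b - a).

Lemma midsum0 G a b : midsum 0 G a b = G ((a + b) / 2) * (b - a).
Proof. by []. Qed.

Lemma midsumS k G a b : midsum k.+1 G a b =
  midsum k G a ((a + b) / 2) + midsum k G ((a + b) / 2) b.
Proof. by []. Qed.

Definition trisum k G a b c := midsum k G a b + midsum k G b c + midsum k G c a.

Lemma midsumN k G a b : midsum k G b a = - midsum k G a b.
Proof.
elim: k a b => [|k IH] a b /=; first by rewrite [b + a]addrC; ring.
by rewrite IH [X in _ + X]IH [b + a]addrC; ring.
Qed.

Lemma midsumB k F G a b :
  midsum k (fun z => F z - G z) a b = midsum k F a b - midsum k G a b.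
Proof. by elim: k a b => [|k IH] a b /=; rewrite ?IH; ring. Qed.

Lemma midsumZ k c G a b : midsum k (fun z => c * G z) a b = c * midsum k G a b.
Proof. by elim: k a b => [|k IH] a b /=; rewrite ?IH; ring. Qed.

(** The midpoint rule is exact on affine functions; hence these sum to zero around a triangle, at
    every level. *)
Lemma midsum_affine k (p q : C) a b :
  midsum k (fun z => p * z + q) a b = (p * (b + a) / 2 + q) * (b - a).
Proof. by elim: k a b => [|k IH] a b /=; rewrite ?IH; field. Qed.

(** Every sample point arises from [a] and [b] by repeated midpoints, hence lies in [K], and the
    pieces have total length |b - a|. *)
Lemma midsum_le K k G (M : R) a b : mid_convex K -> K a -> K b ->
  (forall z, K z -> cmod (G z) <= M) ->
  cmod (midsum k G a b) <= M * cmod (b - a).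
Proof.
move=> cK + + GM; elim: k a b => [|k IH] a b Ka Kb /=.
  by rewrite cmodM ler_wpM2r ?cmod_ge0// GM//; exact: cK.
have Km := cK _ _ Ka Kb.
apply: le_trans (cmodD _ _) _; apply: le_trans (lerD (IH _ _ Ka Km) (IH _ _ Km Kb)) _.
have -> : (a + b) / 2 - a = (b - a) / 2 by field.
have -> : b - (a + b) / 2 = (b - a) / 2 by field.
by rewrite !cmod_half; lra.
Qed.

Lemma trisum_split k G a b c :
  trisum k.+1 G a b c = trisum k G a ((a + b) / 2) ((c + a) / 2)
    + trisum k G ((a + b) / 2) b ((b + c) / 2)
    + trisum k G ((c + a) / 2) ((b + c) / 2) c
    + trisum k G ((a + b) / 2) ((b + c) / 2) ((c + a) / 2).
Proof.
rewrite /trisum /= (midsumN k G ((a + b) / 2) ((c + a) / 2)).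
rewrite (midsumN k G ((a + b) / 2) ((b + c) / 2)).
rewrite (midsumN k G ((b + c) / 2) ((c + a) / 2)); ring.
Qed.

Lemma mid_convex_ball w (r : R) : mid_convex [set z | cmod (z - w) <= r].
Proof.
move=> a b /= ha hb.
have -> : (a + b) / 2 - w = ((a - w) + (b - w)) / 2 by field.
by rewrite cmod_half; have := cmodD (a - w) (b - w); lra.
Qed.

Definition sides_le (d : R) a b c :=
  [/\ cmod (b - a) <= d, cmod (c - b) <= d & cmod (a - c) <= d].

Lemma sides_le_split (d : R) a b c : sides_le (2 * d) a b c ->
  [/\ sides_le d a ((a + b) / 2) ((c + a) / 2),
      sides_le d ((a + b) / 2) b ((b + c) / 2),
      sides_le d ((c + a) / 2) ((b + c) / 2) c &
      sides_le d ((a + b) / 2) ((b + c) / 2) ((c + a) / 2)].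
Proof.
have half x y : cmod y <= 2 * d -> x = y / 2 \/ - x = y / 2 -> cmod x <= d.
  by move=> hy [->|hx]; [|rewrite -cmodN hx]; rewrite cmod_half; lra.
move=> [s1 s2 s3]; split; split.
- by apply: (half _ _ s1); left; field.
- by apply: (half _ _ s2); left; field.
- by apply: (half _ _ s3); left; field.
- by apply: (half _ _ s1); left; field.
- by apply: (half _ _ s2); left; field.
- by apply: (half _ _ s3); left; field.
- by apply: (half _ _ s1); left; field.
- by apply: (half _ _ s2); left; field.
- by apply: (half _ _ s3); left; field.
- by apply: (half _ _ s3); right; field.
- by apply: (half _ _ s1); right; field.
- by apply: (half _ _ s2); right; field.
Qed.

(** Subtracting the affine approximation of [G] at [w] changes no triangle sum; the remainder is at
    most e r on the disc of radius r, and each of the three sides has length at most s. *)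
Lemma trisum_le_local G w c (e d : R) : 0 <= e ->
  (forall z, cmod (z - w) < d -> cmod (G z - G w - c * (z - w)) <= e * cmod (z - w)) ->
  forall k p1 p2 p3 (s r : R), r < d ->
  sides_le s p1 p2 p3 ->
  cmod (p1 - w) <= r -> cmod (p2 - w) <= r -> cmod (p3 - w) <= r ->
  cmod (trisum k G p1 p2 p3) <= e * r * s *+ 3.
Proof.
move=> e0 hG k p1 p2 p3 s r rd [s1 s2 s3] h1 h2 h3.
pose A z := c * z + (G w - c * w).
have -> : trisum k G p1 p2 p3 = trisum k (fun z => G z - A z) p1 p2 p3.
  by rewrite /trisum !midsumB !midsum_affine; field.
have bnd z : cmod (z - w) <= r -> cmod (G z - A z) <= e * r.
  move=> zr; have -> : G z - A z = G z - G w - c * (z - w) by rewrite /A; ring.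
  by apply: le_trans (hG _ (le_lt_trans zr rd)) _; exact: ler_wpM2l.
have er0 : 0 <= e * r by apply: le_trans (bnd _ h1); exact: cmod_ge0.
have side p q : cmod (p - w) <= r -> cmod (q - w) <= r -> cmod (q - p) <= s ->
    cmod (midsum k (fun z => G z - A z) p q) <= e * r * s.
  move=> hp hq hs; apply: le_trans (ler_wpM2l er0 hs).
  exact: (midsum_le k (@mid_convex_ball w r)).
rewrite /trisum !mulrS mulr0n addr0 addrA.
apply: le_trans (cmodD _ _) (lerD _ (side _ _ h3 h1 s3)).
by apply: le_trans (cmodD _ _) (lerD (side _ _ h1 h2 s1) (side _ _ h2 h3 s2)).
Qed.

(** By contradiction: a triangle violating the bound has a medial subtriangle violating a quarter of
    it. The first vertices of the triangles so chosen converge to a point of [K], where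
    differentiability contradicts the violation. *)
Theorem goursat K G a b c : mid_convex K -> cmod_closed K ->
  (forall z, K z -> exists l, has_cderiv G z l) -> K a -> K b -> K c ->
  forall e : R, 0 < e ->
  exists k0, forall k, (k0 <= k)%N -> cmod (trisum k G a b c) <= e.
Proof.
move=> cK clK dG Ka Kb Kc e e0.
pose tri : Type := C * C * C.
(* The sums around [t] are eventually at most x; the negation is what descends to a subtriangle. *)
pose small (x : R) (t : tri) := exists k0, forall k, (k0 <= k)%N ->
  cmod (trisum k G t.1.1 t.1.2 t.2) <= x.
have smallS x t1 t2 t3 t4 : small (4^-1 * x) t1 -> small (4^-1 * x) t2 ->
    small (4^-1 * x) t3 -> small (4^-1 * x) t4 ->
    exists k0, forall k, (k0 <= k)%N -> cmod (trisum k G t1.1.1 t1.1.2 t1.2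
      + trisum k G t2.1.1 t2.1.2 t2.2 + trisum k G t3.1.1 t3.1.2 t3.2
      + trisum k G t4.1.1 t4.1.2 t4.2) <= x.
  move=> [k1 h1] [k2 h2] [k3 h3] [k4 h4].
  exists (maxn (maxn k1 k2) (maxn k3 k4)) => k.
  rewrite !geq_max => /andP[/andP[l1 l2] /andP[l3 l4]].
  have -> : x = 4^-1 * x + 4^-1 * x + 4^-1 * x + 4^-1 * x by field.
  do 3 (apply: le_trans (cmodD _ _) _; apply: lerD; last by auto).
  exact: h1.
(* Adding 1 keeps [d] positive for a degenerate triangle. *)
pose d : R := cmod (b - a) + cmod (c - b) + cmod (a - c) + 1.
have d0 : 0 < d.
  by rewrite /d; move: (cmod_ge0 (b - a)) (cmod_ge0 (c - b)) (cmod_ge0 (a - c)); lra.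
pose inv (j : nat) (t : tri) := [/\ K t.1.1, K t.1.2, K t.2,
  sides_le (d * 2^-1 ^+ j) t.1.1 t.1.2 t.2 & ~ small (e * 4^-1 ^+ j) t].
apply/not_existsP => /= hbad.
have inv0 : inv 0%N (a, b, c).
  split=> //=; last by rewrite expr0 mulr1 => -[k0 hk]; exact: (hbad k0).
  rewrite expr0 mulr1 /d; move: (cmod_ge0 (b - a)) (cmod_ge0 (c - b)) (cmod_ge0 (a - c)).
  by split; lra.
(* The invariant is a premise under the existential, so that [choice] yields a total function. *)
have step (jt : nat * tri) : exists t', inv jt.1 jt.2 ->
    inv jt.1.+1 t' /\ cmod (t'.1.1 - jt.2.1.1) <= d * 2^-1 ^+ jt.1.
  case: jt => j [[p q] r] /=; apply/not_existsP => /= hno.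
  have [Kp Kq Kr [s1 s2 s3] nsm] : inv j (p, q, r).
    by apply: contrapT => ninv; apply: (hno (p, q, r)).
  have Kpq := cK _ _ Kp Kq; have Kqr := cK _ _ Kq Kr; have Krp := cK _ _ Kr Kp.
  have hpos : 0 <= d * 2^-1 ^+ j by rewrite mulr_ge0 ?exprn_ge0// ltW.
  pose good (t : tri) := [/\ K t.1.1, K t.1.2, K t.2,
    sides_le (d * 2^-1 ^+ j.+1) t.1.1 t.1.2 t.2 & cmod (t.1.1 - p) <= d * 2^-1 ^+ j].
  have sub (t : tri) : good t -> small (4^-1 * (e * 4^-1 ^+ j)) t.
    move=> [K1 K2 K3 ss close]; apply: contrapT => ns; apply: (hno t) => _; split=> //.
    by split=> //; rewrite exprS mulrCA.
  have dS : d * 2^-1 ^+ j = 2 * (d * 2^-1 ^+ j.+1) by rewrite exprS; field.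
  have [ss1 ss2 ss3 ss4] : [/\ sides_le (d * 2^-1 ^+ j.+1) p ((p + q) / 2) ((r + p) / 2),
      sides_le (d * 2^-1 ^+ j.+1) ((p + q) / 2) q ((q + r) / 2),
      sides_le (d * 2^-1 ^+ j.+1) ((r + p) / 2) ((q + r) / 2) r &
      sides_le (d * 2^-1 ^+ j.+1) ((p + q) / 2) ((q + r) / 2) ((r + p) / 2)].
    by apply: sides_le_split; rewrite -dS.
  have [] := smallS (e * 4^-1 ^+ j) (p, (p + q) / 2, (r + p) / 2)
    ((p + q) / 2, q, (q + r) / 2) ((r + p) / 2, (q + r) / 2, r)
    ((p + q) / 2, (q + r) / 2, (r + p) / 2).
  - by apply: sub; split=> //=; rewrite subrr cmod0.
  - apply: sub; split=> //=; case: ss1 => s _ _.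
    by rewrite dS; have := cmod_ge0 ((p + q) / 2 - p); lra.
  - apply: sub; split=> //=; case: ss1 => _ _ s.
    by rewrite cmodB dS; have := cmod_ge0 (p - (r + p) / 2); lra.
  - apply: sub; split=> //=; case: ss1 => s _ _.
    by rewrite dS; have := cmod_ge0 ((p + q) / 2 - p); lra.
  by move=> k0 hk0; apply: nsm; exists k0.+1 => -[//|k] /hk0 /=; rewrite trisum_split.
have [f hf] := choice step.
pose u := nat_rect (fun _ => tri) (a, b, c) (fun j t => f (j, t)).
have invu j : inv j (u j).
  by elim: j => [//|j IH] /=; apply: (hf (j, u j) IH).1.
have [j|w hw] := @geometric_limit_Cplx R d (fun j => (u j).1.1).
  exact: (hf (j, u j) (invu j)).2.
have Kw : K w.
  apply: clK => x x0.
  have [|j hj] := @expr_half_lt R (x / (4 * d)); first by rewrite divr_gt0 ?mulr_gt0.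
  exists (u j).1.1; first by case: (invu j).
  apply: le_lt_trans (hw j) _; by rewrite mulrC -ltr_pdivlMr// mulr_gt0.
have [l hl] := dG _ Kw.
(* 15 is 3 times 5: there are three sides, and all vertices lie within 5 d 2^-j of [w], namely 4 d
   2^-j for the first one plus a side of length at most d 2^-j. *)
have [|x x0 hx] := hl (e / (15 * d ^+ 2)).
  by rewrite divr_gt0// mulr_gt0 ?exprn_gt0//; lra.
have [|j hj] := @expr_half_lt R (x / (5 * d)); first by rewrite divr_gt0 ?mulr_gt0.
have [_ _ _ ss nsm] := invu j; apply: nsm; exists 0%N => k _.
have rx : 5 * d * 2^-1 ^+ j < x by rewrite mulrC -ltr_pdivlMr// mulr_gt0.
have hp : 0 < d * 2^-1 ^+ j by rewrite mulr_gt0 ?exprn_gt0//; lra.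
have e' : 0 <= e / (15 * d ^+ 2) by rewrite divr_ge0 ?mulr_ge0 ?exprn_ge0//; lra.
apply: le_trans (@trisum_le_local _ _ _ _ _ e' hx k _ _ _ _ _ rx ss _ _ _) _.
- by have := hw j; lra.
- have := cmod_triangle (u j).1.1 (u j).1.2 w; case: ss => s1 _ _; have := hw j; lra.
- have := cmod_triangle (u j).1.1 (u j).2 w.
  by case: ss => _ _; rewrite cmodB; have := hw j; lra.
have -> : (4^-1 : R) = 2^-1 ^+ 2 by field.
rewrite exprAC -mulr_natr le_eqVlt; apply/orP; left; apply/eqP.
by field; exact: lt0r_neq0.
Qed.

End Goursat.

(** * Complex derivatives *)

(** A positive element of [Cplx] is real, so the tolerances of the limit, which are elements of
    [Cplx], turn into real ones. *)
Lemma derivable_has_cderiv {R : realType} (f : Cplx R -> Cplx R) z :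
  derivable f z 1 -> has_cderiv f z ('D_1 f z).
Proof.
move=> df e e0.
have h : (fun h : Cplx R => h^-1 *: (f (h *: 1 + z) - f z)) @ 0^' --> 'D_1 f z.
  exact: df.
move/cvgrPdist_le : h => /(_ e%:C%C); rewrite ltcR => /(_ e0) [d /= d0 hd].
have d1 : (cmod d)%:C%C = d by rewrite -normCplx gtr0_norm.
exists (cmod d); first by rewrite -ltcR d1.
move=> w hw; have [->|wz] := eqVneq w z.
  by rewrite !subrr mulr0 subrr cmod0 mulr0.
have wz0 : w - z != 0 by rewrite subr_eq0.
have : ball_ Num.norm 0 d (w - z).
  by rewrite /ball_ /= sub0r normrN -d1 normCplx ltcR.
move=> /hd /(_ wz0); rewrite normCplx lecR scaler1 subrK => hh.
rewrite -ler_pdivrMr ?cmod_gt0//.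
apply: le_trans hh; rewrite -cmodV -cmodM cmodB le_eqVlt; apply/orP; left; apply/eqP.
by congr cmod; rewrite /GRing.scale/= mulrBl mulfK// mulrC.
Qed.

Lemma derivable_div_sqr {K : numFieldType} (f : K -> K) (z : K) :
  z != 0 -> derivable f z 1 -> derivable (fun x => f x / x ^+ 2) z 1.
Proof.
move=> z0 df; apply: derivableM => //.
apply: derivableV; first by rewrite expf_neq0.
exact: (@derivableX _ _ id 2 z 1).
Qed.

Lemma is_diff_coord {K : numFieldType} m n (M : 'M[K]_(m, n)) i j :
  is_diff M (fun N : 'M[K]_(m, n) => N i j : K) (fun N => N i j).
Proof.
have lin : linear (fun N : 'M[K]_(m, n) => N i j : K) by move=> ? ? ?; rewrite !mxE.
pose L := GRing.isLinear.Build _ _ _ _ _ lin.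
pose f : {linear _ -> _} := HB.pack (fun N : 'M[K]_(m, n) => N i j : K) L.
apply: DiffDef; first exact: differentiable_coord.
by rewrite (@diff_lin _ _ _ f)//; exact: coord_continuous.
Qed.

(** The chain rule along a complex line through 0. The constant [c] serves to make the function
    vanish at 0. *)
Lemma is_derive_line_coord {K : numFieldType} n m (f : 'rV[K]_n -> 'rV[K]_m)
    (w : 'rV[K]_n) j (t c : K) : differentiable f (t *: w) ->
  is_derive t 1 (fun t : K => f (t *: w) 0 j - c) ((w *m 'J f (t *: w)) 0 j).
Proof.
move=> df.
have /= dg := @is_diff_comp _ _ _ _ _ _ _ _ t (is_diff_scalel t w)
  (@is_diff_comp _ _ _ _ _ _ _ _ (t *: w) (differentiableP df)
  (@is_diff_coord K 1 m (f (t *: w)) 0 j)).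
rewrite -deriveEjacobian// deriveE// -[X in is_derive _ _ _ X]subr0.
have h : is_derive t 1 (fun t : K => f (t *: w) 0 j) ('d f (t *: w) w 0 j).
  apply: DeriveDef; first exact/derivable1_diffP/ex_diff.
  by rewrite deriveE ?diff_val ?scale1r//= ?scale1r.
by have := @is_deriveB _ _ _ _ (cst c) t 1 _ 0 h (is_derive_cst c t 1).
Qed.

(** * The Cauchy estimate *)

Section CauchyEstimate.
Context {R : realType}.
Local Notation C := (Cplx R).
Implicit Types (f G : C -> C) (a b c z w v : C).

(** A convex cap of a disc. For |w| = 1 and r > 0 the half-plane keeps it away from 0, where the
    integrand is singular. *)
Definition disk_segment w (r t : R) : set C :=
  [set z | r <= complex.Re (z * w) /\ cmod z <= t].

Lemma ReD z w : complex.Re (z + w) = complex.Re z + complex.Re w.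
Proof. by case: z; case: w. Qed.

Lemma ReN z : complex.Re (- z) = - complex.Re z.
Proof. by case: z. Qed.

Lemma ReZ (s : R) z : complex.Re (s%:C%C * z) = s * complex.Re z.
Proof. by case: z => x y /=; rewrite mul0r subr0. Qed.

Lemma mid_convex_disk_segment w (r t : R) : mid_convex (disk_segment w r t).
Proof.
move=> a b [ra ta] [rb tb]; split.
  have -> : (a + b) / 2 * w = 2^-1%:C%C * (a * w + b * w).
    by rewrite fmorphV rmorph_nat; field.
  by rewrite ReZ ReD; lra.
by rewrite cmod_half; have := cmodD a b; lra.
Qed.

Lemma cmod_closed_disk_segment w (r t : R) : cmod_closed (disk_segment w r t).
Proof.
move=> z hz; split.
  apply/ler_addgt0Pr => e e0.
  have [|x [rx _] hx] := hz (e / (cmod w + 1)).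
    by rewrite divr_gt0// ltr_wpDl// cmod_ge0.
  have w1 : 0 < cmod w + 1 by rewrite ltr_wpDl// cmod_ge0.
  have : cmod (x - z) * cmod w <= e.
    have := cmod_ge0 (x - z); move: hx; rewrite ltr_pdivlMr// mulrDr; lra.
  have := le_trans (ler_norm _) (cmod_Re ((x - z) * w)).
  have -> : z * w = x * w - (x - z) * w by ring.
  by rewrite cmodM ReD ReN; lra.
apply/ler_addgt0Pr => e /hz[x [_ tx]].
by rewrite cmodB => hx; have := cmodD x (z - x); rewrite addrC subrK; lra.
Qed.

(** The diagonal from [a'] to [b] cuts the trapezoid into two triangles and cancels. *)
Lemma trapezoid_trisum k G a b a' b' :
  trisum k G a' a b + trisum k G a' b b' =
  midsum k G a b - midsum k G a' b' + (midsum k G a' a - midsum k G b' b).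
Proof.
rewrite /trisum (midsumN k G a' b') (midsumN k G b' b) (midsumN k G a' b).
by ring.
Qed.

Lemma goursat_trapezoid K G a b a' b' : mid_convex K -> cmod_closed K ->
  (forall z, K z -> exists l, has_cderiv G z l) ->
  K a -> K b -> K a' -> K b' -> forall e : R, 0 < e ->
  exists k0, forall k, (k0 <= k)%N ->
  cmod (midsum k G a b - midsum k G a' b' + (midsum k G a' a - midsum k G b' b)) <= e.
Proof.
move=> cK clK dG Ka Kb Ka' Kb' e e0.
have e20 : 0 < e / 2 by rewrite divr_gt0.
have [k1 h1] := goursat cK clK dG Ka' Ka Kb e20.
have [k2 h2] := goursat cK clK dG Ka' Kb Kb' e20.
exists (maxn k1 k2) => k; rewrite geq_max => /andP[/h1 h1' /h2 h2'].
by rewrite -trapezoid_trisum (splitr e) (le_trans (cmodD _ _))// lerD.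
Qed.

(** The form dz / z is invariant under z -> u z. A real u relates the inner square to the outer one,
    and u = i relates a side to the next. *)
Lemma midsum_inv_scale k u a b : u != 0 ->
  midsum k GRing.inv (u * a) (u * b) = midsum k GRing.inv a b.
Proof.
move=> u0; elim: k a b => [|k IH] a b /=.
  by rewrite -mulrDr -mulrA -mulrBr invfM mulrACA mulVf// mul1r.
by rewrite -mulrDr -[u * _ / 2]mulrA !IH.
Qed.

(** At a sample point 1/2 + i m with |m| <= 1/2, the imaginary part of i / (1/2 + i m) is (1/2) /
    (1/4 + m^2), which is at least 1. *)
Lemma Im_midsum_inv k (x y : R) : x <= y -> `|x| <= 2^-1 -> `|y| <= 2^-1 ->
  y - x <= complex.Im (midsum k GRing.inv (Complex 2^-1 x : C) (Complex 2^-1 y)).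
Proof.
have mid (s t : R) :
    ((Complex 2^-1 s + Complex 2^-1 t) / 2 : C) = Complex 2^-1 ((s + t) / 2).
  have -> : (2 : C) = (2 : R)%:C%C by rewrite rmorph_nat.
  rewrite -fmorphV; apply/eqP.
  by rewrite eq_complex /=; apply/andP; split; apply/eqP; field.
elim: k x y => [|k IH] x y xy hx hy; rewrite ?midsumS ?midsum0 mid; last first.
  have h1 : x <= (x + y) / 2 by lra.
  have h2 : (x + y) / 2 <= y by lra.
  have h3 : `|(x + y) / 2| <= 2^-1 by move: hx hy; rewrite !ler_norml; lra.
  have := IH _ _ h1 hx h3; have := IH _ _ h2 h3 hy.
  case: (midsum k _ _ _) => ? ?; case: (midsum k _ _ _) => ? ? /=; lra.
move: hx hy; rewrite !ler_norml => /andP[x1 x2] /andP[y1 y2].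
set m := (x + y) / 2.
have m1 : - 2^-1 <= m by rewrite /m; lra.
have m2 : m <= 2^-1 by rewrite /m; lra.
have mm : m ^+ 2 <= 4^-1 by nra.
have -> : (Complex 2^-1 y - Complex 2^-1 x : C) = Complex 0 (y - x).
  by apply/eqP; rewrite eq_complex /= subrr !eqxx.
rewrite /= mulr0 addr0 ler_peMl ?subr_ge0// ler_pdivlMr ?mul1r.
  by rewrite -/m; nra.
by rewrite -/m; have := sqr_ge0 m; nra.
Qed.

Local Notation iC := (Complex 0 1 : C).

Lemma sqr_cmod z : cmod z ^+ 2 = complex.Re z ^+ 2 + complex.Im z ^+ 2.
Proof. by case: z => x y; rewrite sqr_sqrtr// addr_ge0 ?sqr_ge0. Qed.

Lemma disk_segment_cmod_ge w (r t : R) z : cmod w = 1 -> disk_segment w r t z -> r <= cmod z.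
Proof.
move=> w1 [rz _]; apply: le_trans rz (le_trans (ler_norm _) _).
by apply: le_trans (cmod_Re _) _; rewrite cmodM w1 mulr1.
Qed.

(* The normal of the side joining the corner [v] of the square to the next
   corner [i v]: the conjugate of [v + i v]. *)
Definition side_normal v : C :=
  Complex (complex.Re v - complex.Im v) (- (complex.Re v + complex.Im v)).

(** * Corners and sides of the square of side 1 centred at 0 *)

Section Corner.
Variable v : C.
Hypothesis cv : cmod v ^+ 2 = 2^-1.

Lemma cmod_side_normal : cmod (side_normal v) = 1.
Proof.
apply/eqP; rewrite -(@eqrXn2 _ 2) ?cmod_ge0//; apply/eqP.
by move: cv; rewrite !sqr_cmod /=; case: v => x y /=; nra.
Qed.

Lemma cmod_side : cmod (iC * v - v) = 1.
Proof.
apply/eqP; rewrite -(@eqrXn2 _ 2) ?cmod_ge0//; apply/eqP.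
by move: cv; rewrite !sqr_cmod /=; case: v => x y /=; nra.
Qed.

(** A rational bound for 1 / sqrt 2 that is still below 1, the radius of the disc. *)
Lemma cmod_corner : cmod v <= 3 / 4.
Proof. by rewrite -(@ler_pXn2r _ 2) ?nnegrE ?cmod_ge0// cv; lra. Qed.

Lemma corner_next : cmod (iC * v) ^+ 2 = 2^-1.
Proof.
rewrite -cv cmodM exprMn [cmod iC ^+ 2]sqr_cmod /=.
by rewrite expr0n expr1n /= add0r mul1r.
Qed.

(** The real part of [v * side_normal v] is |v|^2 = 1/2, the distance from 0 to the side. *)
Lemma disk_segment_corner (r s : R) : 0 <= s -> r <= s ->
  disk_segment (side_normal v) (r / 2) (s * (3 / 4)) (s%:C%C * v).
Proof.
move=> s0 rs; split; last first.
  by rewrite cmodM cmod_real ger0_norm// ler_wpM2l ?cmod_corner.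
rewrite -mulrA ReZ.
have -> : complex.Re (v * side_normal v) = 2^-1.
  by rewrite -cv sqr_cmod; case: v => x y /=; ring.
by lra.
Qed.

Lemma disk_segment_corner_next (r s : R) : 0 <= s -> r <= s ->
  disk_segment (side_normal v) (r / 2) (s * (3 / 4)) (s%:C%C * (iC * v)).
Proof.
move=> s0 rs; split; last first.
  rewrite !cmodM cmod_real ger0_norm// ler_wpM2l//.
  by rewrite -cmodM -(@ler_pXn2r _ 2) ?nnegrE ?cmod_ge0// corner_next; lra.
rewrite -mulrA ReZ.
have -> : complex.Re (iC * v * side_normal v) = 2^-1.
  by rewrite -cv sqr_cmod; case: v => x y /=; ring.
by lra.
Qed.

End Corner.

Lemma disk_segment_sub w (r r' t t' : R) : r' <= r -> t <= t' ->
  disk_segment w r t `<=` disk_segment w r' t'.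
Proof. by move=> rr tt z [h1 h2]; split; [exact: le_trans h1|exact: le_trans tt]. Qed.

(** * Comparison of the outer and inner boundaries of the shell *)

Section Estimate.
Variables (f : C -> C) (M : R).
Hypothesis df : forall z, cmod z < 1 -> derivable f z 1.
Hypothesis f_le : forall z, cmod z < 1 -> cmod (f z) <= M.

(** Its residue at 0 is f'(0). *)
Let G z := f z / z ^+ 2.

Let zero_lt_disk_segment w (r t : R) z :
  cmod w = 1 -> 0 < r -> disk_segment w r t z -> 0 < cmod z.
Proof. by move=> w1 r0 /(disk_segment_cmod_ge w1); apply: lt_le_trans. Qed.

(** Goursat on the trapezoid between a side and its copy scaled by s. The sums along the two ends
    are kept because they cancel between neighbouring sides. *)
Let side_shell v (s : R) : cmod v ^+ 2 = 2^-1 -> 0 < s -> s <= 1 ->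
  forall e : R, 0 < e -> exists k0, forall k, (k0 <= k)%N ->
  cmod (midsum k G v (iC * v) - midsum k G (s%:C%C * v) (s%:C%C * (iC * v)) +
    (midsum k G (s%:C%C * v) v - midsum k G (s%:C%C * (iC * v)) (iC * v))) <= e.
Proof.
move=> cv s0 s1 e e0.
have w1 := cmod_side_normal cv.
apply: (@goursat_trapezoid (disk_segment (side_normal v) (s / 2) (3 / 4))) => //.
- exact: mid_convex_disk_segment.
- exact: cmod_closed_disk_segment.
- move=> z hz; exists ('D_1 G z); apply: derivable_has_cderiv.
  apply: derivable_div_sqr; last by apply: df; case: hz => _; lra.
  by rewrite -cmod_gt0; apply: zero_lt_disk_segment hz => //; rewrite divr_gt0.
- have := disk_segment_corner cv ler01 s1; rewrite rmorph1 !mul1r; exact.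
- have := disk_segment_corner_next cv ler01 s1; rewrite rmorph1 !mul1r; exact.
- apply: disk_segment_sub (disk_segment_corner cv (ltW s0) (lexx s)) => //; lra.
- apply: disk_segment_sub (disk_segment_corner_next cv (ltW s0) (lexx s)) => //; lra.
Qed.

(** On a side of length 1, where |z| >= 1/2, the integrand is at most 4 M. *)
Let outer_side v k : cmod v ^+ 2 = 2^-1 -> cmod (midsum k G v (iC * v)) <= 4 * M.
Proof.
move=> cv; have w1 := cmod_side_normal cv.
have -> : 4 * M = 4 * M * cmod (iC * v - v) by rewrite cmod_side// mulr1.
apply: (@midsum_le _ (disk_segment (side_normal v) (1 / 2) (3 / 4))).
- exact: mid_convex_disk_segment.
- have := disk_segment_corner cv ler01 (lexx 1); rewrite rmorph1 !mul1r; exact.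
- have := disk_segment_corner_next cv ler01 (lexx 1); rewrite rmorph1 !mul1r; exact.
move=> z hz; have hz1 := disk_segment_cmod_ge w1 hz.
have hz2 : cmod z < 1 by case: hz => _; lra.
have fz := f_le hz2; have M0 := le_trans (cmod_ge0 _) fz.
rewrite cmodM cmodV cmodX ler_pdivrMr ?exprn_gt0//; last by lra.
apply: le_trans fz _; rewrite [4 * M]mulrC -mulrA ler_peMr//; nra.
Qed.

(** As |z| >= s/2 there, G(z) differs from f'(0) / z by at most 2 e / s, along a side of length
    s. *)
Let inner_side v k (s e : R) : cmod v ^+ 2 = 2^-1 -> 0 < s -> s <= 1 -> 0 < e ->
  (forall z, cmod z < s -> cmod (f z - 'D_1 f 0 * z) <= e * cmod z) ->
  cmod (midsum k G (s%:C%C * v) (s%:C%C * (iC * v)) -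
    'D_1 f 0 * midsum k GRing.inv v (iC * v)) <= 2 * e.
Proof.
move=> cv s0 s1 e0 hf; have w1 := cmod_side_normal cv.
have sC : s%:C%C != 0 :> C by rewrite -cmod_gt0 cmod_real gtr0_norm.
rewrite -(midsum_inv_scale k _ _ sC) -midsumZ -midsumB.
have -> : 2 * e = 2 * e / s * cmod (s%:C%C * (iC * v) - s%:C%C * v).
  by rewrite -mulrBr cmodM cmod_side// cmod_real gtr0_norm// mulr1 divfK ?gt_eqF.
apply: (@midsum_le _ (disk_segment (side_normal v) (s / 2) (s * (3 / 4)))).
- exact: mid_convex_disk_segment.
- exact: (disk_segment_corner cv (ltW s0) (lexx s)).
- exact: (disk_segment_corner_next cv (ltW s0) (lexx s)).
move=> z hz; have hz1 := disk_segment_cmod_ge w1 hz.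
have hz2 : cmod z < s by case: hz => _; lra.
have z0 : 0 < cmod z by lra.
have zn0 : z != 0 by rewrite -cmod_gt0.
have -> : G z - 'D_1 f 0 * z^-1 = (f z - 'D_1 f 0 * z) / z ^+ 2.
  by rewrite /G; field.
rewrite cmodM cmodV cmodX ler_pdivrMr ?exprn_gt0//; apply: le_trans (hf _ hz2) _.
rewrite expr2 mulrA ler_pM2r// mulrAC ler_pdivlMr//.
by rewrite [2 * e]mulrC -mulrA ler_pM2l//; lra.
Qed.

Theorem cauchy_estimate : f 0 = 0 -> cmod ('D_1 f 0) <= 4 * M.
Proof.
move=> f0; apply/ler_addgt0Pr => e3 e30.
(* On each side the shell costs e and the inner boundary 2 e. *)
have [e e0 ->] : exists2 e, 0 < e & e3 = 3 * e.
  by exists (e3 / 3); [rewrite divr_gt0|field].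
have /derivable_has_cderiv/(_ _ e0)[d d0 hd] : derivable f 0 1.
  by apply: df; rewrite cmod0.
pose s := Num.min 1 d.
have s0 : 0 < s by rewrite lt_min ltr01.
have s1 : s <= 1 by rewrite ge_min lexx.
have hf z : cmod z < s -> cmod (f z - 'D_1 f 0 * z) <= e * cmod z.
  by rewrite lt_min => /andP[_]; have := hd z; rewrite f0 !subr0.
(* The lower right corner, so that the first side is the vertical one of [Im_midsum_inv]. *)
pose v0 : C := Complex 2^-1 (- 2^-1).
pose v1 := iC * v0; pose v2 := iC * v1; pose v3 := iC * v2.
have v4 : iC * v3 = v0.
  apply/eqP; rewrite eq_complex /=; apply/andP; split; apply/eqP; ring.
have c0 : cmod v0 ^+ 2 = 2^-1 by rewrite sqr_cmod /=; field.
have c1 := corner_next c0; have c2 := corner_next c1; have c3 := corner_next c2.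
have [k0 h0] := side_shell c0 s0 s1 e0.
have [k1 h1] := side_shell c1 s0 s1 e0.
have [k2 h2] := side_shell c2 s0 s1 e0.
have [k3 h3] := side_shell c3 s0 s1 e0.
pose k := maxn (maxn k0 k1) (maxn k2 k3).
have {}h0 := h0 k ltac:(by rewrite /k !leq_max leqnn).
have {}h1 := h1 k ltac:(by rewrite /k !leq_max leqnn orbT).
have {}h2 := h2 k ltac:(by rewrite /k !leq_max leqnn !orbT).
have {}h3 := h3 k ltac:(by rewrite /k !leq_max leqnn !orbT).
have o0 := outer_side k c0; have o1 := outer_side k c1.
have o2 := outer_side k c2; have o3 := outer_side k c3.
have i0 := inner_side k c0 s0 s1 e0 hf; have i1 := inner_side k c1 s0 s1 e0 hf.
have i2 := inner_side k c2 s0 s1 e0 hf; have i3 := inner_side k c3 s0 s1 e0 hf.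
move: h0 h1 h2 h3 o0 o1 o2 o3 i0 i1 i2 i3.
rewrite -/v1 -/v2 -/v3 v4.
have iC0 : iC != 0 by rewrite eq_complex /= oner_eq0 andbF.
have e1 : midsum k GRing.inv v1 v2 = midsum k GRing.inv v0 v1.
  exact: midsum_inv_scale.
have e2 : midsum k GRing.inv v2 v3 = midsum k GRing.inv v0 v1.
  by rewrite -e1; exact: midsum_inv_scale.
have e3' : midsum k GRing.inv v3 v0 = midsum k GRing.inv v0 v1.
  by rewrite -e2 -{1}v4; exact: midsum_inv_scale.
rewrite e1 e2 e3'.
set V := midsum k GRing.inv v0 v1.
have V1 : 1 <= cmod V.
  apply: le_trans (cmod_Im _); apply: le_trans (ler_norm _).
  rewrite /V; have -> : v1 = Complex 2^-1 2^-1.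
    by apply/eqP; rewrite eq_complex /=; apply/andP; split; apply/eqP; ring.
  have := @Im_midsum_inv k (- 2^-1) 2^-1; rewrite -/v0 normrN ger0_norm ?invr_ge0//.
  move/(_ ltac:(lra) (lexx _) (lexx _)); lra.
set c := 'D_1 f 0.
set O0 := midsum k G v0 v1; set O1 := midsum k G v1 v2.
set O2 := midsum k G v2 v3; set O3 := midsum k G v3 v0.
set I0 := midsum k G (_ * v0) (_ * v1); set I1 := midsum k G (_ * v1) (_ * v2).
set I2 := midsum k G (_ * v2) (_ * v3); set I3 := midsum k G (_ * v3) (_ * v0).
set S0 := midsum k G _ v0; set S1 := midsum k G _ v1.
set S2 := midsum k G _ v2; set S3 := midsum k G _ v3.
set X0 := O0 - I0 + _; set X1 := O1 - I1 + _.
set X2 := O2 - I2 + _; set X3 := O3 - I3 + _.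
set Y0 := I0 - _; set Y1 := I1 - _; set Y2 := I2 - _; set Y3 := I3 - _.
move=> h0 h1 h2 h3 o0 o1 o2 o3 i0 i1 i2 i3.
(* The sums along the ends telescope cyclically, so the four [X] terms add up to the outer sums
   minus the inner ones. *)
have key : 4%:R%:C%C * (c * V) =
    (O0 + O1 + O2 + O3) - (X0 + X1 + X2 + X3) - (Y0 + Y1 + Y2 + Y3).
  rewrite rmorph_nat /X0 /X1 /X2 /X3 /Y0 /Y1 /Y2 /Y3; ring.
have tri4 x y z t : cmod (x + y + z + t) <= cmod x + cmod y + cmod z + cmod t.
  by do 3 (apply: le_trans (cmodD _ _) _; rewrite lerD2r).
have := congr1 (@cmod R) key; rewrite cmodM cmod_real normr_nat cmodM.
have := cmodD (O0 + O1 + O2 + O3 - (X0 + X1 + X2 + X3)) (- (Y0 + Y1 + Y2 + Y3)).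
have := cmodD (O0 + O1 + O2 + O3) (- (X0 + X1 + X2 + X3)).
have := tri4 O0 O1 O2 O3; have := tri4 X0 X1 X2 X3; have := tri4 Y0 Y1 Y2 Y3.
(* Since |V| >= 1, the identity gives 4 |c| <= 16 M + 4 e + 8 e. *)
have : cmod c <= cmod c * cmod V by rewrite ler_peMr ?cmod_ge0.
rewrite !cmodN; lra.
Qed.

End Estimate.

End CauchyEstimate.

(** * Volume elements *)

Lemma jacobian_scale_sub {K : numFieldType} n (a : K) (z p : 'rV[K]_n) :
  differentiable (fun w : 'rV[K]_n => a *: (w - z)) p /\
  'J (fun w : 'rV[K]_n => a *: (w - z)) p = a%:M.
Proof.
have [df dv] : is_diff p (fun w : 'rV[K]_n => a *: (w - z)) (fun w => a *: (w - 0)).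
  have h : is_diff p (@id 'rV[K]_n - cst z) (id - 0) by exact: is_diffB.
  by have := @is_diffZ K _ _ _ _ a p h.
split=> //; apply/row_matrixP => i; rewrite !rowE mul_rV_lin1.
by rewrite mul_mx_scalar/= dv subr0.
Qed.

(** * The Euclidean norm and the diameter *)

Section EuclideanNorm.
Context {R : realType} {n : nat}.
Local Notation C := (Cplx R).
Implicit Types (x y z : 'rV[C]_n) (D : set 'rV[C]_n).

Lemma enorm_ge0 x : 0 <= enorm x.
Proof. exact: sqrtr_ge0. Qed.

Lemma sqr_enorm x : enorm x ^+ 2 = \sum_(j < n) cmod (x 0 j) ^+ 2.
Proof. by rewrite sqr_sqrtr// sumr_ge0// => j _; exact: sqr_ge0. Qed.

Lemma cmod_le_enorm x j : cmod (x 0 j) <= enorm x.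
Proof.
rewrite -(@ler_pXn2r _ 2) ?nnegrE ?cmod_ge0 ?enorm_ge0// sqr_enorm.
by rewrite (bigD1 j)//= lerDl sumr_ge0// => i _; exact: sqr_ge0.
Qed.

Lemma enormZ (a : C) x : enorm (a *: x) = cmod a * enorm x.
Proof.
apply/eqP; rewrite -(@eqrXn2 _ 2) ?mulr_ge0 ?enorm_ge0 ?cmod_ge0//.
rewrite exprMn !sqr_enorm mulr_sumr; apply/eqP; apply: eq_bigr => j _.
by rewrite mxE cmodM exprMn.
Qed.

Lemma sqr_enorm_le x (B : R) : (forall j, cmod (x 0 j) <= B) ->
  enorm x ^+ 2 <= n%:R * B ^+ 2.
Proof.
move=> xB; rewrite sqr_enorm mulr_natl -[X in _ *+ X]card_ord -sumr_const.
apply: ler_sum => j _; rewrite ler_pXn2r ?nnegrE ?cmod_ge0//.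
exact: le_trans (cmod_ge0 _) (xB j).
Qed.

(** Carries [bounded_set], which refers to the sup norm with values in [Cplx], over to
    coordinates. *)
Lemma cmod_le_norm x j : (cmod (x 0 j))%:C%C <= `|x| :> C.
Proof.
rewrite -normCplx [leRHS]/Num.norm/= mx_normE -[leLHS]nngE num_le.
exact: (@le_bigmax _ _ _ _ (fun i => `|x i.1 i.2|%:nng) (0, j)).
Qed.

Lemma enorm_le_diam D x y : bounded_set D -> D x -> D y -> enorm (x - y) <= diam D.
Proof.
move=> [M [Mr MD]] Dx Dy; apply: ub_le_sup; last by exists x => //; exists y.
have bnd u j : D u -> cmod (u 0 j) <= cmod M + 1.
  move=> Du; rewrite -lecR; apply: le_trans (cmod_le_norm _ _) _.
  apply: MD => //; rewrite -(@RRe_real _ M) // ltcR.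
  apply: le_lt_trans (ler_norm _) _; apply: le_lt_trans (cmod_Re _) _.
  by rewrite RRe_real// ltrDl.
(* The estimate below bounds the square of the distance; x <= x^2 + 1 does the rest. *)
exists (n%:R * (2 * (cmod M + 1)) ^+ 2 + 1) => _ [u Du [w Dw <-]].
have h : enorm (u - w) ^+ 2 <= n%:R * (2 * (cmod M + 1)) ^+ 2.
  apply: sqr_enorm_le => j; rewrite !mxE; apply: le_trans (cmodD _ _) _.
  by rewrite cmodN; have := bnd u j Du; have := bnd w j Dw; lra.
by have := enorm_ge0 (u - w); nra.
Qed.

End EuclideanNorm.

(** The factor 2 puts the image strictly inside the unit ball. *)
Lemma caratheodory_vol_lower (R : realType) (n : nat) (D : set 'rV[Cplx R]_n)
    (z : 'rV[Cplx R]_n) : bounded_set D -> D z ->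
  ((((2 * diam D)^-1 ^+ n) ^+ 2)%:E <= caratheodory_vol D z)%E.
Proof.
move=> bD Dz; apply: ereal_sup_ubound.
have d0 : 0 <= diam D.
  by apply: le_trans (enorm_le_diam bD Dz Dz); exact: enorm_ge0.
exists (fun w => ((2 * diam D)^-1)%:C%C *: (w - z)); last first.
  rewrite /jac2 (jacobian_scale_sub _ _ _).2 det_scalar cmodX cmod_real ger0_norm//.
  by rewrite invr_ge0 mulr_ge0.
split; last by rewrite subrr scaler0.
split=> w Dw; first exact: (jacobian_scale_sub _ _ _).1.
rewrite /uball/= enormZ cmod_real ger0_norm ?invr_ge0 ?mulr_ge0//.
(* For diameter 0 the inverse is 0 and the map is constantly 0. *)
have := enorm_le_diam bD Dw Dz; move: d0; rewrite le_eqVlt => /orP[/eqP<-|d0 h].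
  by rewrite mulr0 invr0 mul0r.
by rewrite mulrC ltr_pdivrMr ?mulr_gt0//; lra.
Qed.

Lemma cmod_det_le (R : realType) n (A : 'M[Cplx R]_n) (B : R) :
  (forall (l : Cplx R) (v : 'rV_n), v != 0 -> v *m A = l *: v -> cmod l <= B) ->
  cmod (\det A) <= B ^+ n.
Proof.
move=> hB.
have [s hs] := closed_field_poly_normal (char_poly A).
have ls := monicP (char_poly_monic A); rewrite ls scale1r in hs.
have ss : size s = n.
  by apply/eqP; rewrite -eqSS -(size_prod_XsubC s id) -hs size_char_poly.
have -> : cmod (\det A) = \prod_(l <- s) cmod l.
  (* The constant coefficient of the characteristic polynomial is the determinant up to sign. *)
  have := char_poly_det A; rewrite -horner_coef0 hs horner_prod => /(congr1 (@cmod R)).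
  rewrite cmodM cmodX cmodN cmod1 expr1n mul1r => <-.
  rewrite (big_morph _ (@cmodM R) (@cmod1 R)); apply: eq_bigr => l _.
  by rewrite hornerXsubC sub0r cmodN.
have -> : B ^+ n = \prod_(l <- s) B.
  by rewrite big_const_seq count_predT ss iter_mulr_1.
rewrite big_seq [leRHS]big_seq.
apply: ler_prod => l ls'; rewrite cmod_ge0/=.
have : root (char_poly A) l by rewrite hs root_prod_XsubC.
rewrite -eigenvalue_root_char => /eigenvalueP[v vA v0].
exact: hB vA.
Qed.

(** Scaling [v] so that its largest coordinate, the j-th, becomes 1 / sqrt n puts it in the closed
    unit ball. Then t -> psi_j(t w) - z_j lives on the unit disc and has derivative l / sqrt n at
    0. *)
Lemma eigenvalue_jacobian_le (R : realType) n (D : set 'rV[Cplx R]_n)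
    (z : 'rV[Cplx R]_n) psi (l : Cplx R) (v : 'rV_n) : bounded_set D ->
  holo (@uball R n) D psi -> psi 0 = z -> v != 0 -> v *m 'J psi 0 = l *: v ->
  cmod l <= 4 * Num.sqrt n%:R * diam D.
Proof.
move=> bD [dpsi psiD] psi0 v0 vl.
have [j0 vj0] : exists j, v 0 j != 0.
  by apply/existsP; apply: contra_neqT v0 => /existsPn h; apply/rowP => j;
    rewrite mxE; apply/eqP; rewrite -[_ == _]negbK.
pose j := [arg max_(i > j0) cmod (v 0 i)]%O.
have hj i : cmod (v 0 i) <= cmod (v 0 j).
  by rewrite /j; case: arg_maxP => // k _; apply.
have vj : v 0 j != 0 by rewrite -cmod_gt0 (lt_le_trans _ (hj j0)) ?cmod_gt0.
have n0 : (0 < n%:R :> R) by rewrite ltr0n (leq_ltn_trans _ (ltn_ord j0)).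
pose r : R := Num.sqrt n%:R.
have r0 : 0 < r by rewrite sqrtr_gt0.
pose w := ((r%:C%C * v 0 j)^-1) *: v.
have rC : r%:C%C != 0 :> Cplx R by rewrite -cmod_gt0 cmod_real gtr0_norm.
have wj : w 0 j = r%:C%C^-1 by rewrite mxE invfM -mulrA mulVf// mulr1.
have w1 : enorm w <= 1.
  rewrite -(@ler_pXn2r _ 2) ?nnegrE ?enorm_ge0// expr1n.
  have -> : 1 = n%:R * (r^-1) ^+ 2 :> R.
    by rewrite exprVn sqr_sqrtr ?ltW// divff// gt_eqF.
  apply: sqr_enorm_le => i; rewrite mxE cmodM cmodV cmodM cmod_real gtr0_norm//.
  rewrite invfM -mulrA ger_pMr ?invr_gt0// mulrC ler_pdivrMr ?cmod_gt0//.
  by rewrite mul1r.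
have tw (t : Cplx R) : cmod t < 1 -> @uball R n (t *: w).
  by move=> t1; rewrite /uball/= enormZ; have := enorm_ge0 w; have := cmod_ge0 t; nra.
have dline t : cmod t < 1 ->
    is_derive t 1 (fun t : Cplx R => psi (t *: w) 0 j - z 0 j)
      ((w *m 'J psi (t *: w)) 0 j).
  by move=> t1; apply: is_derive_line_coord; apply: dpsi; exact: tw.
have /= h := @cauchy_estimate R (fun t : Cplx R => psi (t *: w) 0 j - z 0 j) (diam D).
have : cmod ('D_1 (fun t : Cplx R => psi (t *: w) 0 j - z 0 j) 0) <= 4 * diam D.
  apply: h => [t t1|t t1|].
  - by case: (dline t t1).
  (* Both psi(t w) and z = psi(0) lie in [D]. *)
  - have : cmod ((psi (t *: w) - z) 0 j) <= diam D.
      apply: le_trans (cmod_le_enorm _ _) (enorm_le_diam bD _ _).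
        exact/psiD/tw.
      by rewrite -psi0; apply: psiD; rewrite -(scale0r w); apply: tw; rewrite cmod0.
    by rewrite !mxE.
  - by rewrite scale0r psi0 subrr.
have [|_ ->] := dline 0; first by rewrite cmod0.
rewrite scale0r -scalemxAl vl scalerA mulrC -scalerA mxE -/w wj cmodM cmodV cmod_real.
rewrite gtr0_norm// ler_pdivrMr// /r; lra.
Qed.

Theorem corollary1p6 (R : realType) (n : nat) (hn : (2 <= n)%N)
    (D : set 'rV[Cplx R]_n) (hD : domain D) (hbD : bounded_set D)
    (hCD : C_convex D) (z : 'rV[Cplx R]_n) (hz : D z) :
  (((16 * n%:R * diam D ^+ 2) ^+ n)^-1%:E <= caratheodory_vol D z)%E /\
  (((16 * n%:R * diam D ^+ 2) ^+ n)^-1%:E <= kobayashi_vol D z)%E.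
Proof.
have n1 : (1 <= n%:R :> R) by rewrite ler1n (ltnW hn).
have n0 : n != 0%N by rewrite -lt0n (ltnW hn).
have d0 : 0 <= diam D.
  by apply: le_trans (enorm_le_diam hbD hz hz); exact: enorm_ge0.
have rhs_ge0 : 0 <= (16 * n%:R * diam D ^+ 2) ^+ n.
  by rewrite exprn_ge0// mulr_ge0 ?sqr_ge0// mulr_ge0.
split.
  apply: le_trans (caratheodory_vol_lower hbD hz); rewrite lee_fin.
  have -> : ((2 * diam D)^-1 ^+ n) ^+ 2 = ((4 * diam D ^+ 2) ^+ n)^-1.
    have <- : (2 * diam D) ^+ 2 = 4 * diam D ^+ 2 by ring.
    by rewrite exprAC !exprVn.
  (* For diameter 0 both sides are the same inverse; otherwise 4 d^2 <= 16 n d^2. *)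
  have [->|dn0] := eqVneq (diam D) 0.
    by rewrite expr0n /= !mulr0.
  have dp : 0 < diam D by rewrite lt_def dn0.
  have d2 : 0 < diam D ^+ 2 by rewrite exprn_gt0.
  rewrite lef_pV2 ?posrE ?exprn_gt0 ?mulr_gt0//; last by lra.
  by rewrite ler_pXn2r ?nnegrE ?lt0n// ?mulr_ge0// ?ler_pM2r//; lra.
apply: le_ereal_inf_tmp => _ [psi [hpsi psi0] <-].
have jle : jac2 psi 0 <= (16 * n%:R * diam D ^+ 2) ^+ n.
  have -> : 16 * n%:R * diam D ^+ 2 = (4 * Num.sqrt n%:R * diam D) ^+ 2.
    by rewrite !exprMn sqr_sqrtr ?ler0n//; ring.
  rewrite exprAC ler_pXn2r ?nnegrE ?cmod_ge0 ?exprn_ge0 ?mulr_ge0 ?sqrtr_ge0//.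
  apply: cmod_det_le => l v; exact: eigenvalue_jacobian_le.
(* A vanishing Jacobian contributes +oo to the infimum. *)
rewrite inver; case: eqP => [_|/eqP j0]; first exact: leey.
have jp : 0 < jac2 psi 0 by rewrite lt_def j0 sqr_ge0.
by rewrite lee_fin lef_pV2 ?posrE// (lt_le_trans jp).
Qed.
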